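(* Let $n$ be a positive integer and let $\psi\colon C^{\infty}([0,1];S^{1})\to\mathbb{R}^{n}$ be continuous with respect to the $L^{1}$-norm (i.e. with respect to the metric $(h_1,h_2)\mapsto\int_0^1|h_1(x)-h_2(x)|\,dx$ on the domain), and suppose that $\psi(-h)=-\psi(h)$ for all $h\in C^{\infty}([0,1];S^{1})$. Then there exists $h\in C^{\infty}([0,1];S^{1})$ with $\psi(h)=0$ and $\|h\|_{W^{1,1}}\le 1+\pi n$.
   Context: $S^{1}$ denotes the unit circle in $\mathbb{C}$, and $C^{\infty}([0,1];S^{1})$ is the set of smooth functions $h\colon[0,1]\to\mathbb{C}$ with values in $S^1$. The $W^{1,1}$-norm is $\|h\|_{W^{1,1}}=\int_{0}^{1}|h(x)|\,dx+\int_{0}^{1}|h'(x)|\,dx$. *)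

(* Defs.v *)
From HB Require Import structures.
From mathcomp Require Import all_boot all_order all_algebra.
From mathcomp Require Import all_classical all_reals all_analysis.
From mathcomp Require Import complex.

Set Implicit Arguments.
Unset Strict Implicit.
Unset Printing Implicit Defensive.
Import Order.TTheory GRing.Theory Num.Theory.
Import numFieldNormedType.Exports.

Local Open Scope classical_set_scope.
Local Open Scope ring_scope.

(* A function [0, 1] -> C is represented by a function on R of which only the
   values on [0, 1] matter: the notions below depend on these values alone.  Two
   representatives of the same function are at L1 distance 0, so an L1-continuous
   psi (see [L1_continuous]) takes the same value on both and is thus a map on
   C^oo([0, 1]; S^1) itself.  The codomain is [Rcomplex R], i.e. R[i] with its
   R-valued modulus as norm. *)

Section DerivativeOnUnitInterval.
Variable R : realType.

(* The points y near x are restricted to [0, 1], so the limit is the one-sided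
   derivative at 0 and at 1. *)
Definition diff_quot (f : R -> R) (x y : R) : R := (f y - f x) / (y - x).

Definition derivable01 (f : R -> R) (x : R) : Prop :=
  cvg (diff_quot f x y @[y --> within `[0, 1] x^']).

Definition deriv01 (f : R -> R) (x : R) : R :=
  lim (diff_quot f x y @[y --> within `[0, 1] x^']).

Definition smooth01 (f : R -> R) : Prop :=
  forall (k : nat) (x : R), x \in `[0, 1] -> derivable01 (iter k deriv01 f) x.

End DerivativeOnUnitInterval.

Section CircleValuedFunctions.
Variable R : realType.
Implicit Types h g : R -> Rcomplex R.

Definition re h : R -> R := fun x => complex.Re (h x).
Definition im h : R -> R := fun x => complex.Im (h x).

Definition cderiv01 h : R -> Rcomplex R :=
  fun x => Complex (deriv01 (re h) x) (deriv01 (im h) x).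

(* C^oo([0, 1]; S^1) *)
Definition Coo_circle : set (R -> Rcomplex R) :=
  [set h | [/\ smooth01 (re h), smooth01 (im h)
             & forall x : R, x \in `[0, 1] -> `|h x| = 1]].

Definition L1norm h : \bar R :=
  (\int[lebesgue_measure]_(x in `[0%R, 1%R]) (`|h x|)%:E)%E.

Definition L1dist h g : \bar R := L1norm (fun x => h x - g x).

Definition W11norm h : \bar R := (L1norm h + L1norm (cderiv01 h))%E.

Definition L1_continuous (n : nat) (psi : (R -> Rcomplex R) -> 'rV[R]_n) :=
  forall h, Coo_circle h -> forall e : R, 0 < e ->
  exists2 d : R, 0 < d & forall g, Coo_circle g ->
    (L1dist h g < d%:E)%E -> `|psi h - psi g| < e.

End CircleValuedFunctions.

(* Main.v *)
From mathcomp Require Import all_boot zify.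
From mathcomp Require Import boolp.

(* The Blaschke products with real Schur parameters a_0, ..., a_(n-1) in [-1, 1]
   followed by 1, restricted to the upper half of the unit circle, form an
   L^1-continuous family of circle-valued maps, smooth even when some a_j = +-1
   because the Schur algorithm then stops at a_j. A Blaschke product with real
   coefficients and degree at most n turns monotonically, by at most pi n on a
   half circle. When some a_j = +-1, negating a_0, ..., a_j negates the product,
   whatever the later parameters are. So psi becomes a continuous map from the
   cube [-1, 1]^n to R^n which is odd on the boundary, and it has a zero by the
   Borsuk-Ulam theorem.

   Borsuk-Ulam is proved on a grid, modulo 2: if the signs of the n coordinates
   are e_1, ..., e_n, Stokes' formula turns the sum over all cells of the cup
   product de_1 ... de_n into the sum of e_1 de_2 ... de_n over the boundary,
   where antipodal cells pair up to the same sum in dimension n - 1. Hence it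
   equals 1, and some cell sees both values of each sign. *)

Set Implicit Arguments.
Unset Strict Implicit.
Unset Printing Implicit Defensive.

(** * The Borsuk-Ulam theorem on a grid *)

Section DiscreteBorsukUlam.
Variable N : nat.
Local Notation point := ('I_N -> nat).
Local Notation "\xor_ ( i 'in' D ) F" := (\big[addb/false]_(i in D) F)
  (at level 41, F at level 41, i, D at level 50).
Local Notation "\xor_ ( i | P ) F" := (\big[addb/false]_(i | P) F)
  (at level 41, F at level 41, i at level 50).

Definition upd (x : point) (i : 'I_N) (v : nat) : point :=
  fun k => if k == i then v else x k.

Lemma updC x i j v w : i != j -> upd (upd x i v) j w = upd (upd x j w) i v.
Proof.
move=> ij; apply/funext => k; rewrite /upd.
by case: eqVneq => [->|//]; rewrite eq_sym (negbTE ij).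
Qed.

(** The terms at (i, j) and (j, i) cancel modulo 2. *)
Lemma xor_offdiag (D : {set 'I_N}) (s : 'I_N -> 'I_N -> bool) :
  (forall i j, s i j = s j i) ->
  \xor_(i in D) \xor_(j in D :\ i) s i j = false.
Proof.
move=> sC.
have -> : \xor_(i in D) \xor_(j in D :\ i) s i j =
  \xor_(i in D) (\xor_(j | (j \in D) && (j < i)) s i j (+)
                 \xor_(j | (j \in D) && (i < j)) s i j).
  apply: eq_bigr => i iD; rewrite (bigID (fun j : 'I_N => j < i)) /=.
  by congr (_ (+) _); apply: eq_bigl => j; rewrite !inE;
    case: (ltngtP i j) => ij; rewrite -(inj_eq val_inj) /= ?andbT ?andbF //; lia.
rewrite big_split /= [X in _ (+) X](exchange_big_dep (mem D)) /=; last first.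
  by move=> i j _ /andP[].
set a := (X in X (+) _); set b := (X in _ (+) X); suff -> : a = b by exact: addbb.
apply: eq_bigr => i iD; apply: eq_big => [j|j _]; last exact: sC.
by move: iD => /= ->.
Qed.


Lemma setD1C (D : {set 'I_N}) i j : D :\ i :\ j = D :\ j :\ i.
Proof. by rewrite !setDDl setUC. Qed.

Lemma xor_offdiagC (D : {set 'I_N}) (s : 'I_N -> 'I_N -> bool) :
  \xor_(i in D) \xor_(j in D :\ i) s i j =
  \xor_(i in D) \xor_(j in D :\ i) s j i.
Proof.
rewrite (exchange_big_dep (mem D)) /=; last by move=> i j _; rewrite !inE => /andP[].
apply: eq_bigr => j jD; apply: eq_bigl => i; rewrite !inE jD andbT eq_sym.
by rewrite andbC.
Qed.

Variables (T : eqType) (F : T -> point -> bool).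

(* The value, modulo 2, of the cup product of the coboundaries of the signs in
   [l] on the cube whose directions are [D], whose first vertex is [x] and whose
   last vertex has coordinates [o]: the sum runs over the monotone edge paths
   from the first vertex to the last one. *)
Fixpoint chains (o x : point) (D : {set 'I_N}) (l : seq T) : bool :=
  if l is t :: l' then
    \xor_(i in D) ((F t x (+) F t (upd x i (o i)))
                   && chains o (upd x i (o i)) (D :\ i) l')
  else D == set0.

(** A product of coboundaries is closed: modulo 2 it sums to 0 over the facets of a cube. After
    expanding one edge, the terms symmetric in the two directions used cancel by [xor_offdiag], and
    the induction hypothesis matches the others. *)
Lemma chains_closed o l x (D : {set 'I_N}) :
  \xor_(j in D) chains o (upd x j (o j)) (D :\ j) l =
  \xor_(j in D) chains o x (D :\ j) l.
Proof.
elim: l x D => [//|t l IH] x D /=.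
under eq_bigr => j jD.
  under eq_bigr do rewrite andb_addl.
  rewrite big_split /= -big_distrr IH /=; over.
rewrite big_split /= [X in _ (+) X]xor_offdiag ?addbF; last first.
  move=> i j; case: (eqVneq i j) => [->//|ij].
  by rewrite updC // setD1C.
under [RHS]eq_bigr => j jD.
  under eq_bigr do rewrite andb_addl.
  rewrite big_split /= -big_distrr IH /=; over.
rewrite big_split /= -big_distrr /= [X in _ && X]xor_offdiag ?andbF; last first.
  by move=> i j; rewrite setD1C.
rewrite addFb; under eq_bigr do rewrite big_distrr /=.
rewrite xor_offdiagC; apply: eq_bigr => i _.
by apply: eq_bigr => j _; rewrite setD1C.
Qed.

(** Stokes on one cube: the coboundary of a sign times a closed cochain is the coboundary of their
    product. *)
Lemma chains_boundary o x D t l :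
  chains o x D (t :: l) =
  \xor_(j in D) ((F t (upd x j (o j)) && chains o (upd x j (o j)) (D :\ j) l)
                 (+) (F t x && chains o x (D :\ j) l)).
Proof.
rewrite /= [in RHS]big_split /= -[in RHS]big_distrr /= -chains_closed.
rewrite big_distrr -big_split /=.
by apply: eq_bigr => i _; rewrite andb_addl addbC.
Qed.

Lemma eq_chains o1 o2 x (D : {set 'I_N}) l :
  {in D, o1 =1 o2} -> chains o1 x D l = chains o2 x D l.
Proof.
elim: l x D => [//|t l IH] x D o12 /=; apply: eq_bigr => i iD.
by rewrite o12 // (IH _ (D :\ i)) // => j; rewrite !inE => /andP[_ /o12].
Qed.

(** A nonzero sum contains a nonzero path, and each sign in [l] changes along one of its edges. *)
Lemma chains_cell o x D l t : chains o x D l -> t \in l ->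
  exists y z, F t y != F t z /\
    forall i, (y i = x i \/ y i = o i) /\ (z i = x i \/ z i = o i).
Proof.
elim: l x D => [//|u l IH] x D /= ch.
have /existsP[i /and3P[iD Fu chi]] :
    [exists i, [&& i \in D, F u x (+) F u (upd x i (o i))
                 & chains o (upd x i (o i)) (D :\ i) l]].
  apply: contraTT ch => /existsPn no; rewrite big1 // => i iD.
  by have := no i; rewrite iD /= => /negbTE.
rewrite inE => /orP[/eqP ->|tl].
  exists x, (upd x i (o i)); split; first by rewrite negb_eqb.
  by move=> k; rewrite /upd; case: eqP => [->|_]; split; auto.
have [y [z [Fyz yz]]] := IH _ _ chi tl; exists y, z; split=> // k.
have := yz k; rewrite /upd; case: eqP => [-> [[->|->] [->|->]]|_ //]; by split; auto.
Qed.

Variable K : nat.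
Hypothesis K_gt0 : 0 < K.
Hypothesis K_even : ~~ odd K.

(* Besides oddness on the boundary of the grid this says that, on a face
   [x_j = 0] or [x_j = K], the signs ignore the coordinates after the j-th. *)
Hypothesis F_antipodal : forall t x x' (j : 'I_N), x j = 0 \/ x j = K ->
  (forall i : 'I_N, i <= j -> x i + x' i = K) -> F t x = ~~ F t x'.

(** Up to the j-th coordinate, both points are antipodal to the same point. *)
Lemma F_collapse t x (i : 'I_N) v (j : 'I_N) : x j = 0 \/ x j = K ->
  (forall i : 'I_N, i <= j -> x i <= K) -> j < i -> F t (upd x i v) = F t x.
Proof.
move=> xj xK ji.
have e y : (forall k : 'I_N, k <= j -> y k = x k) -> F t y = ~~ F t (fun k => K - x k).
  move=> yx; apply: (@F_antipodal t y _ j); first by rewrite yx.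
  by move=> k kj; rewrite yx // subnKC // xK.
rewrite [LHS]e; first by rewrite [RHS]e.
move=> k kj; rewrite /upd ifN //; apply: contraTneq ji => <-.
by rewrite -leqNgt.
Qed.

(** A path exhausting [D] crosses direction [i], along which no sign changes. *)
Lemma chains_collapsed o x (D : {set 'I_N}) l (i j : 'I_N) : x j = 0 \/ x j = K ->
  (forall k : 'I_N, k <= j -> x k <= K) -> (forall k, k \in D -> o k <= K) ->
  j < i -> i \in D -> j \notin D -> chains o x D l = false.
Proof.
elim: l x D => [|t l IH] x D xj xK oK ji iD jD /=.
  by apply/eqP => D0; rewrite D0 inE in iD.
rewrite big1 // => k kD; case: (eqVneq k i) => [->|ki].
  by rewrite (F_collapse _ _ xj xK ji) addbb.
rewrite IH ?andbF //.
- by rewrite /upd ifN //; apply: contraNneq jD => ->.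
- by move=> k' k'j; rewrite /upd; case: eqP => [_|_]; [exact: oK|exact: xK].
- by move=> k'; rewrite !inE => /andP[_ /oK].
- by rewrite !inE eq_sym ki.
- by rewrite !inE negb_and jD orbT.
Qed.

(** The antipodal map negates the signs at both ends of each edge, so the coboundaries are
    unchanged. *)
Lemma chains_antipodal o o' x x' (D : {set 'I_N}) l (j : 'I_N) :
  x j = 0 \/ x j = K -> (forall i : 'I_N, i <= j -> x i + x' i = K) ->
  (forall i : 'I_N, i \in D -> i < j /\ o i + o' i = K) ->
  chains o x D l = chains o' x' D l.
Proof.
elim: l x x' D => [//|t l IH] x x' D xj xx' oo' /=; apply: eq_bigr => i iD.
have [ij oi] := oo' i iD.
have uj : upd x i (o i) j = 0 \/ upd x i (o i) j = K.
  by rewrite /upd ifN //; apply: contraTneq ij => ->; rewrite ltnn.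
have uu' (k : 'I_N) : k <= j -> upd x i (o i) k + upd x' i (o' i) k = K.
  by move=> kj; rewrite /upd; case: eqP => _; [exact: oi|exact: xx'].
rewrite (F_antipodal _ xj xx') (F_antipodal _ uj uu') addbN addNb negbK.
rewrite (IH _ _ _ uj uu') // => k; rewrite !inE => /andP[_]; exact: oo'.
Qed.

(* Each edge [k, k + 1] of the one-dimensional grid is oriented from its even
   to its odd end; since K is even, k |-> K - k respects this orientation. *)
Definition even_end (k : nat) := if odd k then k.+1 else k.
Definition odd_end (k : nat) := if odd k then k else k.+1.

Local Notation cell := {ffun 'I_N -> 'I_K}.

Definition base m (e : cell) : point := fun j => if j < m then even_end (e j) else K.
Definition target (e : cell) : point := fun j => odd_end (e j).
Definition dirs m : {set 'I_N} := [set j : 'I_N | j < m].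
(** Fixing the entries from index [m] on at 0 counts each cell of the m-dimensional face once. *)
Definition face m (e : cell) := [forall j : 'I_N, (m <= j) ==> (e j == 0 :> nat)].
Definition cell_upd (e : cell) (j : 'I_N) (k : 'I_K) : cell :=
  [ffun i => if i == j then k else e i].

Lemma telescope_edge (j : 'I_N) (P : pred cell) (G : cell -> nat -> bool) :
  (forall e k, P (cell_upd e j k) = P e) ->
  (forall e k y, G (cell_upd e j k) y = G e y) ->
  \xor_(e | P e) (G e (odd_end (e j)) (+) G e (even_end (e j))) =
  \xor_(e | P e && (e j == 0 :> nat)) (G e 0 (+) G e K).
Proof.
move=> PU GU; pose z := Ordinal K_gt0.
(* Group the cells into lines in direction [j], each represented by its cell at 0; the sum
   telescopes along each line. *)
rewrite (partition_big (fun e => cell_upd e j z)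
                       (fun e => P e && (e j == 0 :> nat))) /=; last first.
  by move=> e Pe; rewrite PU Pe ffunE eqxx.
apply: eq_bigr => e /andP[Pe /eqP ej].
rewrite (reindex_onto (cell_upd e j) (fun e' => e' j)) /=; last first.
  move=> e' /andP[_ /eqP ee']; apply/ffunP => i; rewrite ffunE.
  by case: eqP => [->//|/eqP ij]; rewrite -ee' ffunE (negbTE ij).
under eq_bigl => k.
  rewrite PU Pe ffunE !eqxx andbT /=.
  have -> : cell_upd (cell_upd e j k) j z == e.
    apply/eqP/ffunP => i; rewrite !ffunE; case: eqP => [->|//].
    by apply: val_inj; rewrite /= ej.
  over.
transitivity (\big[addb/false]_(k < K) (G e k.+1 (+) G e k)).
  apply: eq_bigr => k _; rewrite ffunE eqxx !GU /odd_end /even_end.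
  by case: odd => //; rewrite addbC.
elim: {z PU GU ej e Pe}K (G e) => [g|n IH g]; first by rewrite big_ord0 addbb.
by rewrite big_ord_recr /= IH; case: (g 0); case: (g n); case: (g n.+1).
Qed.

(* The cup product evaluated on the face where the coordinates of index at least
   [m] are equal to [K]. *)
Definition degree m l :=
  \xor_(e | face m e) chains (target e) (base m e) (dirs m) l.

(** The map k |-> K - k on vertices is k |-> K - 1 - k on cells. *)
Definition opposite m (e : cell) : cell :=
  [ffun j : 'I_N => if j < m then rev_ord (e j) else e j].

Lemma oppositeK m : involutive (opposite m).
Proof. by move=> e; apply/ffunP => j; rewrite !ffunE; case: (j < m); rewrite ?rev_ordK. Qed.

Lemma face_opposite m e : face m (opposite m e) = face m e.
Proof.
by apply: eq_forallb => j; rewrite ffunE leqNgt; case: ifP.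
Qed.

Lemma upd_same x i : upd x i (x i) = x.
Proof. by apply/funext => k; rewrite /upd; case: eqP => [->|]. Qed.

Lemma even_end_rev k : k < K -> even_end k + even_end (K - k.+1) = K.
Proof. by move: K_even; rewrite /even_end; do ?case: ifP; lia. Qed.

Lemma odd_end_rev k : k < K -> odd_end k + odd_end (K - k.+1) = K.
Proof. by move: K_even; rewrite /odd_end; do ?case: ifP; lia. Qed.

Lemma even_end_le k : k < K -> even_end k <= K.
Proof. by rewrite /even_end; case: ifP; lia. Qed.

Lemma odd_end_le k : k < K -> odd_end k <= K.
Proof. by rewrite /odd_end; case: ifP; lia. Qed.

(* Stokes: the boundary faces [x_j = 0, K] with [j < m] contribute nothing since
   the signs do not depend on x_m there, and the faces [x_m = 0] and [x_m = K]
   are exchanged by the antipodal map, which negates the leading sign. *)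
Lemma degree_recl m t l : m < N -> degree m.+1 (t :: l) = degree m l.
Proof.
move=> mN; pose j0 := Ordinal mN.
pose G j e y := F t (upd (base m.+1 e) j y)
  && chains (target e) (upd (base m.+1 e) j y) (dirs m.+1 :\ j) l.
have -> : degree m.+1 (t :: l) = \xor_(e | face m.+1 e) \xor_(j in dirs m.+1)
    (G j e (odd_end (e j)) (+) G j e (even_end (e j))).
  apply: eq_bigr => e _; rewrite chains_boundary; apply: eq_bigr => j.
  rewrite inE => jm; congr (_ (+) _).
  rewrite /G; have {1 2}-> : even_end (e j) = base m.+1 e j by rewrite /base jm.
  by rewrite upd_same.
rewrite exchange_big /=.
under eq_bigr => j.
  rewrite inE => jm; rewrite telescope_edge; first last.
  - move=> e k y; rewrite /G.
    have -> : upd (base m.+1 (cell_upd e j k)) j y = upd (base m.+1 e) j y.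
      apply/funext => i; rewrite /upd; case: eqP => // /eqP ij.
      by rewrite /base ffunE (negbTE ij).
    congr (_ && _); apply: eq_chains => i; rewrite !inE => /andP[ij _].
    by rewrite /target ffunE (negbTE ij).
  - move=> e k; apply: eq_forallb => i; rewrite ffunE.
    by case: (i =P j) => [->|//]; rewrite leqNgt jm.
  over.
rewrite (bigD1 j0) /=; last by rewrite inE /=.
rewrite [X in _ (+) X]big1 ?addbF; last first.
  move=> j /andP[]; rewrite inE => jm jj0; apply: big1 => e _.
  have {jj0}jm : j < m.
    by move: jm; rewrite ltnS leq_eqVlt => /orP[/eqP jm|//]; rewrite -val_eqE /= jm eqxx in jj0.
  rewrite /G !(@chains_collapsed _ _ _ _ j0 j) ?andbF //.
  all: rewrite ?/upd ?eqxx ?inE ?eqxx ?andbF /=; auto.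
  - move=> k kj; case: eqP => // _; rewrite /base ltnS (leq_trans kj (ltnW jm)).
    exact: even_end_le.
  - by move=> k _; exact: odd_end_le.
  - by rewrite ltnS leqnn andbT -val_eqE /= gtn_eqF.
  - move=> k kj; case: eqP => // _; rewrite /base ltnS (leq_trans kj (ltnW jm)).
    exact: even_end_le.
  - by move=> k _; exact: odd_end_le.
  - by rewrite ltnS leqnn andbT -val_eqE /= gtn_eqF.
rewrite (eq_bigl (face m)); last first.
  move=> e; apply/andP/forallP => [[/forallP fe e0] k|fe].
    apply/implyP; rewrite leq_eqVlt => /orP[/eqP mk|]; last exact/implyP.
    by have -> : k = j0 by apply: val_inj; rewrite /= mk.
  split; last by have := fe j0; rewrite leqnn.
  by apply/forallP => k; apply/implyP => /ltnW mk; exact: (implyP (fe k)).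
have D0 : dirs m.+1 :\ j0 = dirs m.
  by apply/setP => k; rewrite !inE -val_eqE /= ltnS; case: ltngtP.
have GK e : G j0 e K = F t (base m e) && chains (target e) (base m e) (dirs m) l.
  rewrite /G D0; have -> // : upd (base m.+1 e) j0 K = base m e.
  apply/funext => k; rewrite /upd /base -val_eqE /= ltnS.
  by case: ltngtP.
(* On the opposite cell the leading sign is negated and the remaining chain is the same, so the two
   faces add up to that chain alone. *)
have G0 e : G j0 (opposite m e) 0 =
    ~~ F t (base m e) && chains (target e) (base m e) (dirs m) l.
  rewrite /G D0; set x := upd _ _ _.
  have xj : x j0 = 0 \/ x j0 = K by left; rewrite /x /upd eqxx.
  have xx' (i : 'I_N) : i <= j0 -> x i + base m e i = K.
    move=> im; rewrite /x /upd; case: eqP => [->|/eqP ij].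
      by rewrite /base ltnn.
    have {}im : i < m by rewrite ltn_neqAle -[m]/(val j0) im val_eqE ij.
    by rewrite /base ltnS (ltnW im) im ffunE im addnC even_end_rev.
  rewrite (F_antipodal _ xj xx'); congr (_ && _).
  apply: (chains_antipodal _ xj xx') => i; rewrite inE => im; split=> //.
  by rewrite /target ffunE im addnC odd_end_rev.
rewrite big_split /= (reindex_inj (can_inj (oppositeK m))) /=.
rewrite (eq_bigl (face m)); last exact: face_opposite.
rewrite -big_split /=; apply: eq_bigr => e _; rewrite GK G0.
by rewrite -andb_addl addNb addbb.
Qed.

(** Each step removes one sign and one dimension, down to a single vertex carrying the empty
    product. *)
Lemma degree_odd m l : m <= N -> size l = m -> degree m l.
Proof.
elim: m l => [|m IH] [|t l] //= mN; last first.
  by case=> sl; rewrite degree_recl // IH // ltnW.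
move=> _; rewrite /degree /=.
rewrite (big_pred1 [ffun => Ordinal K_gt0]); last first.
  move=> e; apply/forallP/eqP => [fe|-> j]; last by rewrite ffunE.
  by apply/ffunP => j; apply: val_inj; rewrite ffunE /=; exact/eqP/(implyP (fe j)).
by apply/eqP/setP => j; rewrite !inE.
Qed.

Theorem discrete_borsuk_ulam (l : seq T) : size l = N ->
  exists e : cell, forall t, t \in l -> exists y z, F t y != F t z /\
    forall i, (e i <= y i <= (e i).+1) /\ (e i <= z i <= (e i).+1).
Proof.
move=> sl; have := degree_odd (leqnn N) sl; rewrite /degree.
case: (boolP [exists e, (face N e) && chains (target e) (base N e) (dirs N) l]).
  move=> /existsP[e /andP[_ ch]] _; exists e => t tl.
  have [y [z [yz cyz]]] := chains_cell ch tl; exists y, z; split => // i.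
  have := cyz i; rewrite /base /target ltn_ord /even_end /odd_end.
  by case: odd => -[[] -> [] ->]; rewrite !leqnn !leqnSn.
move=> /existsPn no; rewrite big1 // => e fe.
by have := no e; rewrite fe /= => /negbTE.
Qed.

End DiscreteBorsukUlam.

Require Import Defs.
From mathcomp Require Import all_boot all_order all_algebra.
From mathcomp Require Import all_classical all_reals all_analysis.
From mathcomp Require Import complex.
From mathcomp Require Import measurable_realfun ring lra.
Import Order.TTheory GRing.Theory Num.Theory.
Import numFieldNormedType.Exports.
Local Open Scope classical_set_scope.
Local Open Scope ring_scope.

(** * The Borsuk-Ulam theorem on a cube *)

Lemma row_norm_le (R : realType) n (x : 'rV[R]_n) (a : R) :
  0 <= a -> (forall i, `|x 0 i| <= a) -> `|x| <= a.
Proof.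
move=> a0 xa; rewrite [leLHS]/Num.norm /= mx_normrE; apply: bigmax_le => // -[i j] _.
by rewrite (ord1 i).
Qed.

Lemma row_coord_le (R : realType) n (x : 'rV[R]_n) i : `|x 0 i| <= `|x|.
Proof.
rewrite [leRHS]/Num.norm /= mx_normrE.
exact: (le_bigmax _ (fun ij : 'I_1 * 'I_n => `|x ij.1 ij.2|) (0, i)).
Qed.

Section CubeBorsukUlam.
Variables (R : realType) (n : nat).
Local Notation V := 'rV[R]_n.

Definition cube : set V := [set x | forall i, `|x 0 i| <= 1].

Variable f : V -> V.
Hypothesis f_continuous : forall x, cube x -> forall e : R, 0 < e ->
  exists2 d : R, 0 < d & forall y, cube y -> `|x - y| < d -> `|f x - f y| < e.
(** The coordinates after the j-th are arbitrary: this reflects that a Schur parameter of modulus 1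
    ends the algorithm, and it yields [F_antipodal] on the grid. *)
Hypothesis f_antipodal : forall x y (j : 'I_n), cube x -> cube y ->
  `|x 0 j| = 1 -> (forall i : 'I_n, (i <= j)%N -> y 0 i = - x 0 i) ->
  f y = - f x.

(** * Signs on a grid of mesh 1 / m *)

Section Grid.
Variable m : nat.
Hypothesis m_gt0 : (0 < m)%N.
Let K := m.*2.

(** The coordinates 0, ..., K cover [-1, 1] in steps of 1 / m; [minn] sends larger ones to 1, so
    every vertex lands in the cube. *)
Definition grid_point (x : 'I_n -> nat) : V :=
  \row_i ((minn (x i) K)%:R / m%:R - 1).

Lemma mR_gt0 : 0 < m%:R :> R. Proof. by rewrite ltr0n. Qed.

Lemma cube_grid_point x : cube (grid_point x).
Proof.
move=> i; rewrite mxE ler_norml; have m0 := mR_gt0.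
rewrite lerBrDr addNr divr_ge0 //= ?ler0n // lerBlDr ler_pdivrMr //.
by rewrite -[1 + 1]/(2%:R) -natrM ler_nat mul2n geq_minr.
Qed.

Definition extreme (x : 'I_n -> nat) j := (x j == 0%N) || (x j == K).

(* Breaks ties at the zeros of a coordinate of [f], in an odd way. *)
Definition tie (x : 'I_n -> nat) :=
  [exists j, (x j == K) && [forall i : 'I_n, (i < j)%N ==> ~~ extreme x i]].

Lemma tieE x j : extreme x j -> (forall i : 'I_n, (i < j)%N -> ~~ extreme x i) ->
  tie x = (x j == K).
Proof.
move=> xj xi; apply/existsP/idP => [[k /andP[/eqP xk /forallP ik]]|xK].
  case: (ltngtP j k) => [jk|kj|/val_inj -> //]; last 2 first.
  - by have := xi _ kj; rewrite /extreme xk eqxx orbT.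
  - by rewrite xk.
  by have := ik j; rewrite jk xj.
by exists j; rewrite xK /=; apply/forallP => i; apply/implyP => /xi.
Qed.

Definition sgn (t : 'I_n) (x : 'I_n -> nat) :=
  (0 < f (grid_point x) 0 t) || ((f (grid_point x) 0 t == 0) && tie x).

(** The first extreme coordinate has index at most [j]; it has the same index for both points, at
    opposite ends. *)
Lemma tie_antipodal x x' (j : 'I_n) : x j = 0%N \/ x j = K ->
  (forall i : 'I_n, (i <= j)%N -> (x i + x' i = K)%N) -> tie x = ~~ tie x'.
Proof.
move=> xj xx'; have {}xj : extreme x j by rewrite /extreme; case: xj => ->; rewrite eqxx ?orbT.
have K0 : (0 < K)%N by rewrite double_gt0.
case: (arg_minnP (fun i : 'I_n => i : nat) xj) => k xk kmin.
have kj : (k <= j)%N by exact: kmin.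
have ext (i : 'I_n) : (i <= j)%N -> extreme x' i = extreme x i.
  by move=> /xx'; rewrite /extreme orbC => ?; congr (_ || _); apply/eqP/eqP; lia.
have xi (i : 'I_n) : (i < k)%N -> ~~ extreme x i.
  by move=> ik; apply/negP => /kmin; rewrite leqNgt ik.
rewrite (tieE xk xi) (@tieE x' k); first last.
- by move=> i ik; rewrite ext ?xi // (leq_trans (ltnW ik)).
- by rewrite ext.
have := xx' _ kj; move: xk => /orP[] /eqP ->; rewrite ?eqxx ?add0n.
  by move=> ->; rewrite eqxx /=; apply/eqP; lia.
by move=> x0; have -> : x' k = 0%N by [lia]; rewrite eq_sym -lt0n K0.
Qed.

Lemma sgn_antipodal t x x' (j : 'I_n) : x j = 0%N \/ x j = K ->
  (forall i : 'I_n, (i <= j)%N -> (x i + x' i = K)%N) -> sgn t x = ~~ sgn t x'.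
Proof.
move=> xj xx'; rewrite /sgn (tie_antipodal xj xx').
have m0 := mR_gt0.
rewrite (@f_antipodal (grid_point x') (grid_point x) j); first last.
- move=> i /xx' xi; rewrite !mxE !(minn_idPl _); [|lia..].
  have -> : x i = (K - x' i)%N by lia.
  rewrite natrB; last by lia.
  by rewrite /K -mul2n natrM; field; rewrite lt0r_neq0.
- have := xx' _ (leqnn j); rewrite mxE; case: xj => ->; rewrite ?add0n => xj.
    rewrite xj minnn /K -mul2n natrM mulfK ?lt0r_neq0 //.
    by rewrite -[2%:R]/(1 + 1) addrK normr1.
  have -> : x' j = 0%N by lia.
  by rewrite min0n mul0r sub0r normrN1.
- exact: cube_grid_point.
- exact: cube_grid_point.
rewrite mxE; case: (ltrgtP (f (grid_point x') 0 t) 0) => [h|h|->].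
- by rewrite oppr_gt0 h.
- by rewrite oppr_gt0 ltNge (ltW h) oppr_eq0 gt_eqF.
- by rewrite oppr0 ltxx eqxx /=.
Qed.

(** The vertices of a cell on which every sign changes are within 1 / m of its lowest vertex, which
    serves as [p]. *)
Lemma approximate_zero : exists2 p, cube p & forall t, exists y z,
  [/\ cube y, cube z, `|p - y| <= m%:R^-1, `|p - z| <= m%:R^-1
    & f z 0 t <= 0 <= f y 0 t].
Proof.
have K0 : (0 < K)%N by rewrite double_gt0.
have [e ecell] := @discrete_borsuk_ulam n _ sgn K K0 (negbT (odd_double m))
  sgn_antipodal (enum 'I_n) (size_enum_ord n).
exists (grid_point (fun i => e i)) => [|t]; first exact: cube_grid_point.
have m0 := mR_gt0.
have near y : (forall i, (e i <= y i <= (e i).+1)%N) ->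
    `|grid_point (fun i => e i) - grid_point y| <= m%:R^-1.
  move=> ey; apply: row_norm_le => [|i]; first by rewrite invr_ge0 ler0n.
  have [eK /andP[ey1 ey2]] := (ltn_ord (e i), ey i).
  rewrite !mxE !(minn_idPl _) ?(leq_trans ey2) // 1?ltnW // opprB addrA subrK -mulrBl.
  rewrite normrM [`|m%:R^-1|]ger0_norm ?invr_ge0 ?ler0n //.
  rewrite ler_piMl ?invr_ge0 ?ler0n // distrC ger0_norm ?subr_ge0 ?ler_nat //.
  by rewrite lerBlDl natr1 ler_nat.
have [y [z [yz cyz]]] := ecell t (mem_enum _ _).
have pos x : sgn t x -> 0 <= f (grid_point x) 0 t.
  by case/orP => [/ltW //|/andP[/eqP -> _]].
have neg x : ~~ sgn t x -> f (grid_point x) 0 t <= 0.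
  by rewrite negb_or -leNgt => /andP[].
have [yn zn] : `|grid_point (fun i => e i) - grid_point y| <= m%:R^-1 /\
               `|grid_point (fun i => e i) - grid_point z| <= m%:R^-1.
  by split; apply: near => i; have [] := cyz i.
case: (boolP (sgn t y)) yz => [sy|sy]; case: (boolP (sgn t z)) => [sz|sz] // _.
  by exists (grid_point y), (grid_point z); split; rewrite ?pos ?neg //; exact: cube_grid_point.
by exists (grid_point z), (grid_point y); split; rewrite ?pos ?neg //; exact: cube_grid_point.
Qed.
End Grid.

(** By compactness the approximate zeros on finer and finer grids cluster at some x; a coordinate of
    f nonzero at x would keep its sign nearby. *)
Theorem cube_borsuk_ulam : exists2 x, cube x & f x = 0.
Proof.
have /choice[p pP] (m : nat) : exists p, cube p /\ forall t, exists y z,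
    [/\ cube y, cube z, `|p - y| <= m.+1%:R^-1, `|p - z| <= m.+1%:R^-1
      & f z 0 t <= 0 <= f y 0 t].
  by have [p cp pP] := @approximate_zero m.+1 isT; exists p.
have cube_compact : compact cube.
  have segC (i : 'I_n) : compact (`[-1, 1]%classic : set R) by exact: segment_compact.
  rewrite (_ : cube = [set v : V | forall i, `[-1, 1]%classic (v ord0 i)]).
    exact: (rV_compact segC).
  by apply/seteqP; split => x cx i; have := cx i; rewrite /= in_itv /= ler_norml.
have [x [cx clx]] : (cube `&` cluster (p @ \oo)) !=set0.
  by apply: cube_compact; exists 0%N => // m _; have [] := pP m.
exists x => //; apply/rowP => t; rewrite mxE; apply/eqP/negPn/negP => fx0.
have e0 : 0 < `|f x 0 t| by rewrite normr_gt0.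
have [d d0 fd] := f_continuous cx e0.
have d2 : 0 < d / 2 by rewrite divr_gt0.
have [_ [[m md <-] xpm]] : (p @` [set m | m.+1%:R^-1 < d / 2] `&` ball x (d / 2)) !=set0.
  apply: clx; last exact: nbhsx_ballx.
  by have := near_infty_natSinv_lt (PosNum d2); apply: filterS => m md; exists m.
have [_ /(_ t)[y [z [cy cz py pz /andP[fz fy]]]]] := pP m.
have near w : cube w -> `|p m - w| <= m.+1%:R^-1 -> `|f x 0 t - f w 0 t| < `|f x 0 t|.
  move=> cw pw; have -> : f x 0 t - f w 0 t = (f x - f w) 0 t by rewrite !mxE.
  apply: le_lt_trans (row_coord_le _ _) _; apply: fd => //.
  rewrite -(subrK (p m) x) -addrA; apply: le_lt_trans (ler_normD _ _) _.
  rewrite [d]splitr ltrD //; last exact: le_lt_trans pw md.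
  by move: xpm; rewrite mx_norm_ball.
have := near _ cy py; have := near _ cz pz.
case: (ltrgtP (f x 0 t) 0) => [h|h|h]; last by rewrite h eqxx in fx0.
  rewrite (ltr0_norm h) !ltr_norml; lra.
rewrite (gtr0_norm h) !ltr_norml; lra.
Qed.

End CubeBorsukUlam.

(** * Smooth functions on the unit interval *)

Section SmoothFunctions.
Variable R : realType.
Implicit Types f g : R -> R.

(** Two-sided derivatives on the whole line, given by witnesses, so that closure under the
    operations goes by induction on [k]. *)
Fixpoint Ck (k : nat) f : Prop :=
  if k is k'.+1 then exists2 g : R -> R, forall x : R, is_derive x 1 f (g x) & Ck k' g
  else True.

Definition smooth f := forall k, Ck k f.

Lemma CkW k f : Ck k.+1 f -> Ck k f.
Proof. by elim: k f => [//|k IH] f [g fg /IH gk]; exists g. Qed.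

Lemma Ck_cst k (c : R) : Ck k (fun=> c).
Proof. by elim: k c => [//|k IH] c; exists (fun=> 0) => // x; exact: is_derive_cst. Qed.

Lemma Ck_id k : Ck k (fun x => x).
Proof.
case: k => [//|k]; exists (fun=> 1); last exact: Ck_cst.
by move=> x; exact: is_derive_id.
Qed.

Lemma Ck_add k f g : Ck k f -> Ck k g -> Ck k (fun x => f x + g x).
Proof.
elim: k f g => [//|k IH] f g [f' ff' f'k] [g' gg' g'k].
exists (fun x => f' x + g' x); last exact: IH.
by move=> x; have := is_deriveD (ff' x) (gg' x).
Qed.

Lemma Ck_mul k f g : Ck k f -> Ck k g -> Ck k (fun x => f x * g x).
Proof.
elim: k f g => [//|k IH] f g fk gk; have := fk; have := gk.
move=> [g' gg' g'k] [f' ff' f'k].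
exists (fun x => f x * g' x + g x * f' x).
  by move=> x; have := is_deriveM (ff' x) (gg' x).
by apply: Ck_add; apply: IH => //; exact: CkW.
Qed.

Lemma Ck_inv k f : (forall x, f x != 0) -> Ck k f -> Ck k (fun x => (f x)^-1).
Proof.
move=> f0; elim: k => [//|k IH] fk; have := fk; move=> [f' ff' f'k].
exists (fun x => (-1) * ((f x)^-1 * (f x)^-1 * f' x)).
  move=> x; have := is_deriveV (f0 x) (ff' x).
  by rewrite /GRing.scale /= expr2 invfM !mulrA mulN1r !mulNr.
apply: Ck_mul; first exact: Ck_cst.
by apply: Ck_mul => //; apply: Ck_mul; apply: IH; exact: CkW.
Qed.

Lemma is_derive_sin_comp f (x d : R) :
  is_derive x 1 f d -> is_derive x 1 (fun y => sin (f y)) (cos (f x) * d).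
Proof. by move=> fd; exact: (@is_derive1_comp _ sin f). Qed.

Lemma is_derive_cos_comp f (x d : R) :
  is_derive x 1 f d -> is_derive x 1 (fun y => cos (f y)) (- sin (f x) * d).
Proof. by move=> fd; exact: (@is_derive1_comp _ cos f). Qed.

(** Proved jointly because each function occurs in the derivative of the other. *)
Lemma Ck_sin_cos k f : Ck k f -> Ck k (fun x => sin (f x)) /\ Ck k (fun x => cos (f x)).
Proof.
elim: k => [//|k IH] fk; have := fk; move=> [f' ff' f'k].
have [sk ck] := IH (CkW fk); split.
  exists (fun x => cos (f x) * f' x); last exact: Ck_mul.
  by move=> x; exact: is_derive_sin_comp.
exists (fun x => (-1) * sin (f x) * f' x).
  by move=> x; rewrite mulN1r; exact: is_derive_cos_comp.
by do 2?[apply: Ck_mul => //]; exact: Ck_cst.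
Qed.

Lemma smooth_cst (c : R) : smooth (fun=> c).
Proof. by move=> k; exact: Ck_cst. Qed.

Lemma smooth_is_derive f : smooth f -> forall x : R, is_derive x 1 f ((derive1 f) x).
Proof.
by move=> /(_ 1%N)[g fg _] x; have [fx dfx] := fg x; apply: DeriveDef => //; rewrite derive1E.
Qed.

Lemma smooth_derive f : smooth f -> smooth (derive1 f).
Proof.
move=> fs k; have [g fg gk] := fs k.+1.
by rewrite (_ : (derive1 f) = g) //; apply/funext => x; rewrite derive1E derive_val.
Qed.

Lemma smooth_continuous f : smooth f -> continuous f.
Proof.
move=> fs x; apply: differentiable_continuous; apply/derivable1_diffP.
by have [] := smooth_is_derive fs x.
Qed.

(** Two functions agreeing on [0, 1] are involved because an iterated [deriv01] is known only
    there. *)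
Lemma cvg_diff_quot f g (x d : R) : x \in `[0, 1] ->
  (forall y : R, y \in `[0, 1] -> f y = g y) -> is_derive x 1 g d ->
  diff_quot f x y @[y --> within `[0, 1] x^'] --> d.
Proof.
move=> x01 fg [gx <-]; apply/cvgrPdist_lt => e e0.
have /cvgrPdist_lt/(_ e e0)[r /= r0 rP] := gx.
exists r => //= y xy yx y01; rewrite /diff_quot !fg //.
have yx0 : y - x != 0 by rewrite subr_eq0.
have := rP (y - x) _ yx0; rewrite /= sub0r opprB => /(_ xy).
by rewrite /GRing.scale /= mulr1 subrK mulrC.
Qed.

(** This makes the limit in [deriv01] unique. A point of [0, 1] can move by up to 1 / 2 inside the
    interval, rightwards if x <= 1 / 2 and leftwards otherwise. *)
Lemma within01_proper (x : R) : x \in `[0, 1] -> ProperFilter (within `[(0 : R), 1] x^').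
Proof.
move=> x01; apply: Build_ProperFilter_ex => P [r /= r0 rP].
move: x01; rewrite in_itv /= => /andP[x0 x1].
pose s := Num.min r 1 / 2.
have s0 : 0 < s by rewrite /s divr_gt0 // lt_min r0 ltr01.
have sr : s < r.
  have rm : Num.min r 1 <= r by rewrite ge_min lexx.
  by rewrite /s; move: (Num.min r 1) rm => q; lra.
have s1 : s <= 1/2 by rewrite /s ler_pM2r ?invr_gt0 // ge_min lexx orbT.
case: (lerP x (1 / 2)) => x2.
  exists (x + s); apply: rP => /=; last first.
  - by rewrite in_itv /=; lra.
  - by rewrite -subr_eq0 addrAC subrr add0r gt_eqF.
  - by rewrite opprD addNKr normrN gtr0_norm.
exists (x - s); apply: rP => /=; last first.
- by rewrite in_itv /=; lra.
- by rewrite -subr_eq0 addrAC subrr add0r oppr_eq0 gt_eqF.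
- by rewrite opprB addrC subrK gtr0_norm.
Qed.

Lemma deriv01E f g (x d : R) : x \in `[0, 1] ->
  (forall y : R, y \in `[0, 1] -> f y = g y) -> is_derive x 1 g d -> deriv01 f x = d.
Proof.
move=> x01 fg gd; have := within01_proper x01 => Hp.
by apply: cvg_lim => //; exact: cvg_diff_quot fg gd.
Qed.

Lemma smooth_smooth01 f : smooth f -> smooth01 f.
Proof.
move=> fs k x x01.
suff [g gs fg] : exists2 g, smooth g & forall y : R, y \in `[0, 1] -> iter k (@deriv01 R) f y = g y.
  apply/cvg_ex; exists ((derive1 g) x); apply: (cvg_diff_quot x01 fg).
  exact: smooth_is_derive.
elim: k => [|k [g gs fg]]; first by exists f.
exists (derive1 g); first exact: smooth_derive.
by move=> y y01; apply: (deriv01E y01 fg); exact: smooth_is_derive.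
Qed.

Local Notation mu := (@lebesgue_measure R).

Lemma integral_derivative (F f : R -> R) : (forall x : R, is_derive x 1 F (f x)) ->
  continuous f -> (\int[mu]_(x in `[0%R, 1%R]) (f x)%:E = (F 1 - F 0)%:E)%E.
Proof.
move=> Ff fc; rewrite EFinB; apply: continuous_FTC2 => //.
- exact: continuous_subspaceT.
- have Fc : continuous F.
    move=> x; apply: differentiable_continuous; apply/derivable1_diffP.
    by have [] := Ff x.
  split; first by move=> x _; have [] := Ff x.
  + by apply: cvg_at_right_filter; exact: Fc.
  + by apply: cvg_at_left_filter; exact: Fc.
- by move=> x _; rewrite derive1E derive_val.
Qed.

Lemma integral_le_derivative (F f h : R -> R) : (forall x : R, is_derive x 1 F (f x)) ->
  continuous f -> continuous h -> (forall x : R, x \in `[0, 1] -> 0 <= h x <= f x) ->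
  (\int[mu]_(x in `[0%R, 1%R]) (h x)%:E <= (F 1 - F 0)%:E)%E.
Proof.
move=> Ff fc hc hf; rewrite -(integral_derivative Ff fc).
have mE (g : R -> R) : continuous g -> measurable_fun (`[0, 1]%classic : set R) g.
  by move=> gc; apply: subspace_continuous_measurable_fun => //; exact: continuous_subspaceT.
apply: ge0_le_integral => //; try (by apply/measurable_EFinP; exact: mE).
  by move=> x x01; rewrite lee_fin; have /andP[] := hf x x01.
by move=> x x01; rewrite lee_fin; have /andP[] := hf x x01.
Qed.

End SmoothFunctions.

(** * Arguments of Moebius transformations of the circle *)

Section Moebius.
Variable R : realType.
Implicit Types a b p q t : R.

(** The squared modulus of 1 + a exp(i p). *)
Definition mob_den a p := 1 + 2 * a * cos p + a ^+ 2.

(* A lift of [w |-> (a + w) / (1 + a w)] to arguments: this quotient is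
   [w conj(d) / d] with [d = 1 + a w] in the right half plane. *)
Definition mob a p := p - 2 * atan (a * sin p / (1 + a * cos p)).

Lemma sinE2 p : sin p * sin p = 1 - cos p * cos p.
Proof. by have := cos2Dsin2 p; rewrite !expr2; lra. Qed.

Lemma cos_bounds p : -1 <= cos p <= 1.
Proof. by rewrite cos_geN1 cos_le1. Qed.

Lemma mob_lin_gt0 a p : `|a| < 1 -> 0 < 1 + a * cos p.
Proof.
move=> a1; have : `|a * cos p| < 1.
  rewrite normrM (le_lt_trans _ a1) // ler_piMr // ler_norml; exact: cos_bounds.
by rewrite ltr_norml => /andP[]; lra.
Qed.

Lemma mob_den_ge a r p : `|a| <= r -> r < 1 -> (1 - r) ^+ 2 <= mob_den a p.
Proof.
move=> ar r1; have /andP[c1 c2] := cos_bounds p; rewrite /mob_den.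
case: (lerP 0 a) ar => [a0|a0]; [rewrite ger0_norm // | rewrite ltr0_norm //] => ar.
  have : 0 <= a * (1 + cos p) by rewrite mulr_ge0 //; lra.
  have : (1 - r) ^+ 2 <= (1 - a) ^+ 2 by rewrite lerXn2r // ?nnegrE; lra.
  by rewrite !expr2; lra.
have : 0 <= - a * (1 - cos p) by rewrite mulr_ge0 //; lra.
have : (1 - r) ^+ 2 <= (1 + a) ^+ 2 by rewrite lerXn2r // ?nnegrE; lra.
by rewrite !expr2; lra.
Qed.

Lemma mob_den_gt0 a p : `|a| < 1 -> 0 < mob_den a p.
Proof.
by move=> a1; apply: lt_le_trans (mob_den_ge p (lexx _) a1); rewrite exprn_gt0 // subr_gt0.
Qed.

Lemma mob_den_sqr a p :
  mob_den a p = (1 + a * cos p) ^+ 2 + a ^+ 2 * (sin p * sin p).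
Proof. by rewrite sinE2 /mob_den; ring. Qed.

(** Here [u] is the tangent of the argument of 1 + a exp(i p); both sides are the squared cosine of
    that argument. *)
Lemma mob_tangent a p (u := a * sin p / (1 + a * cos p)) : `|a| < 1 ->
  (1 + u ^+ 2)^-1 = (1 + a * cos p) ^+ 2 / mob_den a p.
Proof.
move=> a1; have v0 := lt0r_neq0 (mob_lin_gt0 p a1); rewrite -[RHS]invf_div.
by congr (_^-1); rewrite mob_den_sqr /u; field.
Qed.

Lemma mob_double_angle a p (th := atan (a * sin p / (1 + a * cos p))) : `|a| < 1 ->
  cos th * cos th = (1 + a * cos p) ^+ 2 / mob_den a p /\
  cos th * sin th = (1 + a * cos p) * (a * sin p) / mob_den a p.
Proof.
move=> a1; have v0 := mob_lin_gt0 p a1; have D0 := mob_den_gt0 p a1.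
pose u := a * sin p / (1 + a * cos p).
have u1 : 0 < 1 + u ^+ 2 by rewrite ltr_pwDl // sqr_ge0.
have cc : cos th * cos th = (1 + u ^+ 2)^-1.
  by rewrite /th cos_atan -invfM -expr2 sqr_sqrtr // ltW.
have c0 : cos th != 0.
  apply: contraTneq u1 => c0; move: cc; rewrite c0 mul0r => /esym/eqP.
  by rewrite invr_eq0 => /eqP ->; rewrite ltxx.
have sE : sin th = u * cos th.
  by rewrite -[u](atanK u) /tan -/th mulfVK.
have uE := mob_tangent p a1; rewrite -/u in uE.
split; first by rewrite cc uE.
by rewrite sE mulrCA cc uE /u; field; rewrite !lt0r_neq0.
Qed.

(** With w = exp(i p), this is the real part of (a + w) (1 + a conj(w)) / |1 + a w|^2; [sin_mob] is
    the imaginary part. *)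
Lemma cos_mob a p : `|a| < 1 ->
  cos (mob a p) = ((1 + a ^+ 2) * cos p + 2 * a) / mob_den a p.
Proof.
move=> a1; have [cc cs] := mob_double_angle p a1.
have D0 := lt0r_neq0 (mob_den_gt0 p a1).
rewrite /mob mulr_natl mulr2n cosB cosD sinD; set th := atan _ in cc cs *.
have -> : cos p * (cos th * cos th - sin th * sin th) +
          sin p * (sin th * cos th + cos th * sin th) =
          cos p * (2 * (cos th * cos th) - 1) + 2 * sin p * (cos th * sin th).
  by rewrite sinE2; ring.
rewrite cc cs.
transitivity ((cos p * (2 * (1 + a * cos p) ^+ 2 - mob_den a p) +
    2 * (1 + a * cos p) * a * (sin p * sin p)) / mob_den a p); first by field.
by congr (_ / _); rewrite sinE2 /mob_den; ring.
Qed.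

Lemma sin_mob a p : `|a| < 1 ->
  sin (mob a p) = (1 - a ^+ 2) * sin p / mob_den a p.
Proof.
move=> a1; have [cc cs] := mob_double_angle p a1.
have D0 := lt0r_neq0 (mob_den_gt0 p a1).
rewrite /mob mulr_natl mulr2n sinB cosD sinD; set th := atan _ in cc cs *.
have -> : sin p * (cos th * cos th - sin th * sin th) -
          cos p * (sin th * cos th + cos th * sin th) =
          sin p * (2 * (cos th * cos th) - 1) - 2 * cos p * (cos th * sin th).
  by rewrite sinE2; ring.
rewrite cc cs /mob_den; field; exact: D0.
Qed.

(** The points 1 and -1 of the circle are fixed, and the lift adds no turn there; the total turn of
    [phase] is computed from this. *)
Lemma mob_sin0 a p : sin p = 0 -> mob a p = p.
Proof. by move=> p0; rewrite /mob p0 mulr0 mul0r atan0 mulr0 subr0. Qed.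

(** The factor multiplying [d] is a Poisson kernel; its positivity makes the argument increase. *)
Lemma is_derive_mob a (f : R -> R) t (d : R) : `|a| < 1 -> is_derive t 1 f d ->
  is_derive t 1 (fun x => mob a (f x)) ((1 - a ^+ 2) / mob_den a (f t) * d).
Proof.
move=> a1 fd; have v0 := lt0r_neq0 (mob_lin_gt0 (f t) a1).
have D0 := lt0r_neq0 (mob_den_gt0 (f t) a1).
set p := f t in v0 D0.
have cst (c : R) : is_derive t 1 (fun=> c) (0 : R) by exact: is_derive_cst.
have sd : is_derive t 1 (fun x => a * sin (f x)) (a * (cos p * d)).
  by have := is_deriveM (cst a) (is_derive_sin_comp fd); rewrite /GRing.scale /= mulr0 addr0.
have vd : is_derive t 1 (fun x => 1 + a * cos (f x)) (a * (- sin p * d)).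
  have := is_deriveD (cst 1) (is_deriveM (cst a) (is_derive_cos_comp fd)).
  by rewrite /GRing.scale /= mulr0 addr0 add0r.
have ud := is_deriveM sd (@is_deriveV _ (fun x => 1 + a * cos (f x)) t _ 1 v0 vd).
have ad := @is_derive1_comp _ atan _ t _ _ (is_derive1_atan _) ud.
have := is_deriveB fd (is_deriveM (cst 2) ad).
rewrite /GRing.scale /= mulr0 addr0 -/p.
move=> /is_derive_eq; apply.
rewrite (mob_tangent p a1).
have -> : 1 - a ^+ 2 = mob_den a p -
    2 * (a * cos p * (1 + a * cos p) + a ^+ 2 * (sin p * sin p)).
  by rewrite sinE2 /mob_den; ring.
by field; rewrite v0 D0.
Qed.


Definition circle_dist p q := `|cos p - cos q| + `|sin p - sin q|.

(** The l^1 distance is not rotation invariant: each new coordinate difference is at most the sum of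
    the two old ones, hence the factor 2. *)
Lemma circle_dist_rotate p q t :
  circle_dist (p + t) (q + t) <= 2 * circle_dist p q.
Proof.
rewrite /circle_dist !cosD !sinD.
have b (x y z w : R) : `|x| <= 1 -> `|y| <= 1 -> `|z * x + w * y| <= `|z| + `|w|.
  move=> x1 y1; apply: le_trans (ler_normD _ _) _.
  by rewrite !normrM lerD // ler_piMr.
have ct : `|cos t| <= 1 by rewrite ler_norml; exact: cos_bounds.
have st : `|sin t| <= 1 by rewrite ler_norml sin_geN1 sin_le1.
have sNt : `|- sin t| <= 1 by rewrite normrN.
have -> : cos p * cos t - sin p * sin t - (cos q * cos t - sin q * sin t) =
  (cos p - cos q) * cos t + (sin p - sin q) * - sin t by ring.
have -> : sin p * cos t + cos p * sin t - (sin q * cos t + cos q * sin t) =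
  (sin p - sin q) * cos t + (cos p - cos q) * sin t by ring.
have := b _ _ (cos p - cos q) (sin p - sin q) ct sNt.
have := b _ _ (sin p - sin q) (cos p - cos q) ct st.
lra.
Qed.

Lemma quotient_dist (x y d e m : R) : 0 < m -> m <= d -> 0 < e -> `|y / e| <= 1 ->
  `|x / d - y / e| <= m^-1 * (`|x - y| + `|d - e|).
Proof.
move=> m0 md e0 ye; have d0 : 0 < d by exact: lt_le_trans md.
have -> : x / d - y / e = d^-1 * ((x - y) + (y / e) * (e - d)).
  by field; rewrite !lt0r_neq0.
rewrite normrM gtr0_norm ?invr_gt0 //.
apply: ler_pM; [by rewrite invr_ge0 ltW|exact: normr_ge0|by rewrite lef_pV2|].
by apply: le_trans (ler_normD _ _) _; rewrite lerD2l normrM [`|e - d|]distrC ler_piMl.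
Qed.

(** The constant 14 is 2 + 4 + 2 * 4, the coefficients of |a - b| from the sine numerator, the
    cosine numerator and the denominator, which occurs in both quotients. *)
Lemma circle_dist_mob a b r p q : `|a| <= r -> `|b| <= r -> r < 1 ->
  circle_dist (mob a p) (mob b q) <=
  14 * (1 - r) ^- 2 * (`|a - b| + circle_dist p q).
Proof.
move=> ar br r1; have a1 := le_lt_trans ar r1; have b1 := le_lt_trans br r1.
have m0 : 0 < (1 - r) ^+ 2 by rewrite exprn_gt0 // subr_gt0.
have cb : `|cos (mob b q)| <= 1 by rewrite ler_norml; exact: cos_bounds.
have sb : `|sin (mob b q)| <= 1 by rewrite ler_norml sin_geN1 sin_le1.
rewrite /circle_dist; rewrite cos_mob // in cb *; rewrite sin_mob // in sb *.
rewrite (cos_mob p a1) (sin_mob p a1).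
have D1 := mob_den_ge p ar r1; have D2 := mob_den_gt0 q b1.
have := quotient_dist ((1 + a ^+ 2) * cos p + 2 * a) m0 D1 D2 cb.
have := quotient_dist ((1 - a ^+ 2) * sin p) m0 D1 D2 sb.
set X := `|_ / _ - _|; set Y := `|_ / _ - _|.
set A := `|_ - _|; set B := `|_ - _|; set C := `|_ - _| => XB YB.
have a2 : `|a| <= 1 by exact: ltW. have b2 : `|b| <= 1 by exact: ltW.
have n1 (x y : R) : `|x| <= 1 -> `|x * y| <= `|y| by move=> x1; rewrite normrM ler_piMl.
have cq : `|cos q| <= 1 by rewrite ler_norml; exact: cos_bounds.
have sq : `|sin q| <= 1 by rewrite ler_norml sin_geN1 sin_le1.
have ab : `|(a + b) * (a - b)| <= 2 * `|a - b|.
  by rewrite normrM ler_wpM2r // (le_trans (ler_normD _ _)) //; lra.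
have aa' : `|a ^+ 2| <= 1 by rewrite normrX exprn_ile1.
have aa : `|1 - a ^+ 2| <= 1.
  by have := sqr_ge0 a; move: aa'; rewrite !ler_norml; lra.
have B1 : B <= 2 * `|cos p - cos q| + 4 * `|a - b|.
  rewrite /B /mob_den (_ : _ - _ = 2 * (a * (cos p - cos q)) +
     (2 * (cos q * (a - b)) + (a + b) * (a - b))); last by ring.
  have := n1 _ (cos p - cos q) a2; have := n1 _ (a - b) cq.
  have := ler_normD (2 * (a * (cos p - cos q))) (2 * (cos q * (a - b)) + (a + b) * (a - b)).
  have := ler_normD (2 * (cos q * (a - b))) ((a + b) * (a - b)).
  rewrite [`|2 * (a * _)|]normrM [`|2 * (cos q * _)|]normrM [`|2|]ger0_norm //; lra.
have A1 : A <= `|sin p - sin q| + 2 * `|a - b|.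
  rewrite /A (_ : _ - _ = (1 - a ^+ 2) * (sin p - sin q) -
     sin q * ((a + b) * (a - b))); last by ring.
  have := n1 _ (sin p - sin q) aa; have := n1 _ ((a + b) * (a - b)) sq.
  have := ler_normB ((1 - a ^+ 2) * (sin p - sin q)) (sin q * ((a + b) * (a - b))); lra.
have C1 : C <= 2 * `|cos p - cos q| + 4 * `|a - b|.
  rewrite /C (_ : _ - _ = (cos p - cos q) + a ^+ 2 * (cos p - cos q) +
     (cos q * ((a + b) * (a - b)) + 2 * (a - b))); last by ring.
  have := n1 _ (cos p - cos q) aa'; have := n1 _ ((a + b) * (a - b)) cq.
  have := ler_normD (cos p - cos q + a ^+ 2 * (cos p - cos q))
     (cos q * ((a + b) * (a - b)) + 2 * (a - b)).
  have := ler_normD (cos p - cos q) (a ^+ 2 * (cos p - cos q)).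
  have := ler_normD (cos q * ((a + b) * (a - b))) (2 * (a - b)).
  rewrite [`|2 * (a - b)|]normrM [`|2|]ger0_norm //; lra.
apply: le_trans (lerD YB XB) _; rewrite -mulrDr [14 * _]mulrC -mulrA.
rewrite ler_wpM2l ?invr_ge0 ?(ltW m0) //.
have := normr_ge0 (a - b); have := normr_ge0 (cos p - cos q); have := normr_ge0 (sin p - sin q).
by lra.
Qed.

(* Harnack-type estimate: as [b] tends to [s = +-1] the image of the circle
   point [q] tends to [s], in square mean with respect to the Poisson kernel. *)
Lemma circle_dist_mob_boundary b s e q p : `|b| < 1 -> (s = 1 \/ s = -1) ->
  cos p = s -> sin p = 0 -> 0 < e ->
  circle_dist p (mob b q) <=
  e + 2 * (1 - s * b) / (e * (1 + s * b)) * ((1 - b ^+ 2) / mob_den b q).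
Proof.
move=> b1 s1 cp sp e0.
have D0 := mob_den_gt0 q b1.
have [h1 h2] : 0 < 1 - s * b /\ 0 < 1 + s * b.
  by move: b1; rewrite ltr_norml; case: s1 => ->; lra.
(* Weighted so that the constant terms of the two coordinates add up to [e]. *)
have amgm (x : R) : `|x| <= e / 2 + x ^+ 2 / (2 * e).
  rewrite -[x ^+ 2]real_normK ?num_real //; set y := `|x|.
  have -> : e / 2 + y ^+ 2 / (2 * e) = ((y - e) ^+ 2) / (2 * e) + y.
    by field; exact: lt0r_neq0.
  by rewrite lerDr divr_ge0 ?sqr_ge0 // mulr_ge0 // ltW.
have ss : s * s = 1 by case: s1 => ->; ring.
set c := cos (mob b q); set d := sin (mob b q).
have sq : (s - c) ^+ 2 + (0 - d) ^+ 2 = 2 - 2 * (s * c).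
  have := cos2Dsin2 (mob b q); rewrite -/c -/d !expr2 => cd.
  by transitivity (s * s + (c * c + d * d) - 2 * (s * c)); [ring|rewrite ss cd].
(* The squared distance equals 2 (1 - s b)^2 (1 - s cos q) / [mob_den b q], and 1 - s cos q <= 2. *)
have le : (s - c) ^+ 2 + (0 - d) ^+ 2 <=
   4 * (1 - s * b) / (1 + s * b) * ((1 - b ^+ 2) / mob_den b q).
  rewrite sq /c cos_mob //.
  have -> : 1 - b ^+ 2 = (1 - s * b) * (1 + s * b).
    by rewrite mulrDr mulrBl mulr1 mulrBl !mul1r [s * b * _]mulrACA ss; ring.
  have -> : 2 - 2 * (s * (((1 + b ^+ 2) * cos q + 2 * b) / mob_den b q)) =
     2 * (1 - s * b) ^+ 2 * (1 - s * cos q) / mob_den b q.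
    have E : 2 * (1 - s * b) ^+ 2 * (1 - s * cos q) =
       2 * mob_den b q - 2 * s * ((1 + b ^+ 2) * cos q + 2 * b).
      by rewrite /mob_den; case: s1 => ->; ring.
    by rewrite E; field; exact: lt0r_neq0.
  have -> : 4 * (1 - s * b) / (1 + s * b) * ((1 - s * b) * (1 + s * b) / mob_den b q) =
     4 * (1 - s * b) ^+ 2 / mob_den b q.
    by field; rewrite !lt0r_neq0.
  rewrite ler_wpM2r ?invr_ge0 ?(ltW D0) //.
  have : 0 <= (1 - s * b) ^+ 2 * (1 + s * cos q).
    rewrite mulr_ge0 ?sqr_ge0 //.
    by have /andP[] := cos_bounds q; case: s1 => ->; lra.
  by lra.
rewrite /circle_dist cp sp -/c -/d.
apply: le_trans (lerD (amgm _) (amgm _)) _.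
rewrite addrACA -splitr lerD2l -mulrDl.
apply: le_trans (ler_wpM2r _ le) _; first by rewrite invr_ge0 mulr_ge0 // ltW.
by rewrite le_eqVlt; apply/orP; left; apply/eqP; field; rewrite !lt0r_neq0.
Qed.

End Moebius.

(** * Arguments of Blaschke products *)

Section Phase.
Variable R : realType.
Implicit Types (a : nat -> R) (t : R).

(* [t |-> exp (i * phase n a t)] is, on the upper half of the unit circle
   [z = exp (i pi t)], the finite Blaschke product with real Schur parameters
   [a 0, ..., a (n - 1), 1]; the Schur algorithm stops at the first parameter of
   modulus 1. *)
Fixpoint phase (n : nat) a t : R :=
  if n is n'.+1 then
    if `|a 0%N| < 1 then mob (a 0%N) (phase n' (fun k => a k.+1) t + pi * t)
    else if 0 < a 0%N then 0 else pi
  else 0.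

(** Real coefficients make the product real at z = 1 and z = -1, whence the two vanishing sines; by
    [mob_sin0] they let each further factor add exactly pi to the turn. *)
Definition monotone_phase n (f : R -> R) :=
  [/\ smooth f, forall t, 0 <= derive1 f t, sin (f 0) = 0, sin (f 1) = 0
    & f 1 - f 0 <= pi * n%:R].

Lemma smooth_rotate (f : R -> R) : smooth f -> smooth (fun t => f t + pi * t).
Proof.
move=> fs k; apply: Ck_add => //; apply: Ck_mul; [exact: Ck_cst|exact: Ck_id].
Qed.

Lemma smooth_mob (b : R) (f : R -> R) : `|b| < 1 -> smooth f -> smooth (fun t => mob b (f t)).
Proof.
move=> b1 fs [//|k]; exists (fun t => (1 - b ^+ 2) * (mob_den b (f t))^-1 * derive1 f t).
  by move=> x; apply: is_derive_mob => //; exact: smooth_is_derive.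
apply: Ck_mul; last exact: smooth_derive.
apply: Ck_mul; first exact: Ck_cst.
apply: Ck_inv; first by move=> x; exact/lt0r_neq0/mob_den_gt0.
apply: Ck_add; last exact: Ck_cst.
apply: Ck_add; first exact: Ck_cst.
by apply: Ck_mul; [exact: Ck_cst|exact: (Ck_sin_cos (fs k)).2].
Qed.

Lemma derive_rotate (f : R -> R) t : smooth f ->
  derive1 (fun x => f x + pi * x) t = derive1 f t + pi.
Proof.
move=> fs; have pd : is_derive t (1 : R) (fun x : R => pi * x) (pi : R).
  have := is_deriveM (is_derive_cst (pi : R) t (1 : R)) (is_derive_id t (1 : R)).
  by rewrite /GRing.scale /= mulr0 addr0 mulr1.
have := is_deriveD (smooth_is_derive fs t) pd => h.
by rewrite derive1E; exact: (@derive_val _ _ _ _ _ _ _ h).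
Qed.

Lemma derive_mob_rotate (b : R) (f : R -> R) t : `|b| < 1 -> smooth f ->
  derive1 (fun x => mob b (f x + pi * x)) t =
  (1 - b ^+ 2) / mob_den b (f t + pi * t) * (derive1 f t + pi).
Proof.
move=> b1 fs; rewrite -derive_rotate // derive1E.
have h := is_derive_mob b1 (smooth_is_derive (smooth_rotate fs) t).
exact: (@derive_val _ _ _ _ _ _ _ h).
Qed.

Lemma subr_sqr_ge0 (b : R) : `|b| < 1 -> 0 <= 1 - b ^+ 2.
Proof. by move=> b1; rewrite subr_ge0 -real_normK ?num_real // exprn_ile1 // ltW. Qed.

Lemma monotone_phase_step n (b : R) (f : R -> R) : `|b| < 1 -> monotone_phase n f ->
  monotone_phase n.+1 (fun t => mob b (f t + pi * t)).
Proof.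
move=> b1 [fs f'0 f0 f1 fn]; split.
- by apply: smooth_mob => //; exact: smooth_rotate.
- move=> t; rewrite derive_mob_rotate // mulr_ge0 //.
    by rewrite divr_ge0 ?subr_sqr_ge0 // ltW // mob_den_gt0.
  by rewrite addr_ge0 // pi_ge0.
- by rewrite mulr0 addr0 mob_sin0.
- by rewrite mulr1 mob_sin0 sinDpi f1 oppr0.
- rewrite mulr0 mulr1 addr0 !mob_sin0 ?sinDpi ?f1 ?oppr0 //.
  by rewrite -natr1 mulrDr mulr1; lra.
Qed.

Lemma monotone_phase_cst n (c : R) : sin c = 0 -> monotone_phase n (fun=> c).
Proof.
move=> c0; split => //; first exact: smooth_cst.
  by move=> t; rewrite derive1_cst.
by rewrite subrr mulr_ge0 // pi_ge0.
Qed.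

Lemma phaseP n a : monotone_phase n (phase n a).
Proof.
elim: n a => [|n IH] a /=; first by apply: monotone_phase_cst; exact: sin0.
case: (ltP `|a 0%N| 1) => [a1|_].
  exact: (monotone_phase_step a1 (IH (fun k => a k.+1))).
by apply: monotone_phase_cst; case: ifP; rewrite ?sin0 ?sinpi.
Qed.

Lemma normr_eq1 (x : R) : `|x| = 1 -> x = 1 \/ x = -1.
Proof.
by case: (lerP 0 x) => h; rewrite ?(ger0_norm h) ?(ltr0_norm h) => <-;
  [left|right; rewrite opprK].
Qed.

Definition opposite_on_circle (p q : R) := cos q = - cos p /\ sin q = - sin p.

(** The quotient (a + w) / (1 + a w) is odd in the pair (a, w), and the first parameter of modulus 1
    gives opposite constants to start from. *)
Lemma phase_antipodal n a b j t : (j < n)%N -> `|a j| = 1 ->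
  (forall i, (i <= j)%N -> b i = - a i) -> (forall i, `|a i| <= 1) ->
  opposite_on_circle (phase n a t) (phase n b t).
Proof.
elim: n a b j => [//|n IH] a b j jn aj ba a1 /=; rewrite ba // normrN.
case: ltP => [a01|a01]; last first.
  have {}a01 : `|a 0%N| = 1 by apply/eqP; rewrite eq_le a1.
  case: (normr_eq1 a01) => ->; rewrite /opposite_on_circle ?opprK ltr01 ltr0N1 /=.
    by rewrite cos0 cospi sin0 sinpi oppr0.
  by rewrite cos0 cospi sin0 sinpi opprK oppr0.
case: j jn aj ba => [|j] jn aj ba; first by rewrite aj ltxx in a01.
have [c s] := IH (fun k => a k.+1) (fun k => b k.+1) j jn aj
  (fun i ij => ba i.+1 ij) (fun i => a1 i.+1).
have Na1 : `|- a 0%N| < 1 by rewrite normrN.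
set p := phase n _ t + _; set q := phase n _ t + _.
have [cq sq] : cos q = - cos p /\ sin q = - sin p.
  by rewrite /p /q !cosD !sinD c s; split; ring.
have D : mob_den (- a 0%N) q = mob_den (a 0%N) p.
  by rewrite /mob_den cq; ring.
rewrite /opposite_on_circle !cos_mob // !sin_mob // D cq sq.
by split; rewrite -[RHS]mulNr; congr (_ / _); ring.
Qed.

(* Closeness in the L^1 distance, witnessed by an antiderivative of a majorant. *)
Definition close (p q : R -> R) (e : R) := exists F f : R -> R,
  [/\ forall t : R, is_derive t 1 F (f t), continuous f,
      forall t, circle_dist (p t) (q t) <= f t & F 1 - F 0 <= e].

Lemma is_derive_affine (c d : R) (F : R -> R) (t f : R) : is_derive t 1 F f ->
  is_derive t 1 (fun x => c * x + d * F x) (c + d * f).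
Proof.
move=> Ff.
have := is_deriveD (is_deriveM (is_derive_cst (c : R) t (1 : R)) (is_derive_id t (1 : R)))
  (is_deriveM (is_derive_cst (d : R) t (1 : R)) Ff).
by rewrite /GRing.scale /= !mulr0 !addr0 mulr1.
Qed.

Lemma continuous_affine (c d : R) (f : R -> R) : continuous f ->
  continuous (fun x => c + d * f x).
Proof.
by move=> fc x; apply: cvgD; [exact: cvg_cst|apply: cvgM; [exact: cvg_cst|exact: fc]].
Qed.

(** If |a 0| < 1, the Lipschitz estimate reduces to the later parameters. If |a 0| = 1, the phase of
    [a] is constant and [circle_dist_mob_boundary] applies: the Poisson kernel is dominated by the
    derivative of the phase of [b] over pi, whose integral is at most n + 1. *)
Lemma phase_continuous n a : (forall i, `|a i| <= 1) -> forall e, 0 < e ->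
  exists2 d : R, 0 < d & forall b, (forall i, `|b i| <= 1) ->
    (forall i, `|a i - b i| < d) -> close (phase n a) (phase n b) e.
Proof.
elim: n a => [|n IH] a a1 e e0.
  exists 1 => // b _ _; exists (fun=> 0), (fun=> 0); split => //.
  - by move=> t; exact: is_derive_cst.
  - by move=> x; exact: cvg_cst.
  - by move=> t; rewrite /circle_dist !subrr normr0 addr0.
  - by rewrite subrr ltW.
case: (ltP `|a 0%N| 1) => [a01|a01].
  (* The midpoint of |a 0| and 1, leaving room for the nearby [b 0]. *)
  pose r := (1 + `|a 0%N|) / 2.
  have r1 : r < 1 by rewrite /r; lra.
  have ar : `|a 0%N| <= r by rewrite /r; lra.
  pose K := 14 * (1 - r) ^- 2.
  have K0 : 0 < K by rewrite mulr_gt0 // invr_gt0 exprn_gt0 // subr_gt0.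
  have e4 : 0 < e / (4 * K) by rewrite divr_gt0 // mulr_gt0.
  have [d d0 dP] := IH (fun k => a k.+1) (fun k => a1 k.+1) _ e4.
  (* The three bounds control the later parameters, keep |b 0| <= r, and give K |a 0 - b 0| <= e /
     2. *)
  pose d' := Num.min d (Num.min ((1 - `|a 0%N|) / 2) (e / (2 * K))).
  exists d'.
    by rewrite !lt_min d0 /= !divr_gt0 ?subr_gt0 // mulr_gt0.
  move=> b b1 ab.
  have [abd abr abe] : [/\ forall i, `|a i - b i| < d,
     `|a 0%N - b 0%N| < (1 - `|a 0%N|) / 2 & `|a 0%N - b 0%N| < e / (2 * K)].
    by split=> [i||]; [have := ab i|have := ab 0%N|have := ab 0%N];
      rewrite !lt_min => /and3P[].
  have br : `|b 0%N| <= r.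
    have := ler_normB (a 0%N) (a 0%N - b 0%N); rewrite opprB addrC subrK /r; lra.
  have [F [f [Ff fc fd Fe]]] := dP (fun k => b k.+1) (fun k => b1 k.+1) (fun k => abd k.+1).
  exists (fun t => K * `|a 0%N - b 0%N| * t + 2 * K * F t),
         (fun t => K * `|a 0%N - b 0%N| + 2 * K * f t); split.
  - by move=> t; exact: is_derive_affine.
  - exact: continuous_affine.
  - move=> t /=; rewrite a01 (le_lt_trans br r1).
    apply: le_trans (circle_dist_mob _ _ ar br r1) _; rewrite -/K mulrDr lerD2l.
    rewrite (_ : 2 * K * f t = K * (2 * f t)); last by ring.
    rewrite ler_wpM2l ?(ltW K0) //.
    apply: le_trans (circle_dist_rotate _ _ _) _; rewrite ler_wpM2l //.
  - rewrite mulr1 mulr0 add0r.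
    have : K * `|a 0%N - b 0%N| <= e / 2.
      rewrite mulrC -ler_pdivlMr // ltW //.
      by rewrite (_ : e / 2 / K = e / (2 * K)) //; field; exact: lt0r_neq0.
    have : K * (F 1 - F 0) <= e / 4.
      rewrite mulrC -ler_pdivlMr //.
      by rewrite (_ : e / 4 / K = e / (4 * K)) //; field; exact: lt0r_neq0.
    lra.
have {}a01 : `|a 0%N| = 1 by apply/eqP; rewrite eq_le a1.
pose s := a 0%N.
have s1 : s = 1 \/ s = -1 by exact: normr_eq1.
pose N : R := n.+1%:R; have N0 : 0 < N by rewrite ltr0n.
(* The bound 1 gives s * b 0 > 0; the other one gives k * N <= e / 2 for the [k] below. *)
pose d := Num.min 1 (e ^+ 2 / (8 * N)).
exists d; first by rewrite lt_min ltr01 divr_gt0 ?exprn_gt0 // mulr_gt0.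
move=> b b1 ab.
have [d1 d2] : `|s - b 0%N| < 1 /\ `|s - b 0%N| < e ^+ 2 / (8 * N).
  by have := ab 0%N; rewrite lt_min => /andP[].
have ss : s * s = 1 by case: s1 => ->; ring.
have sb : `|s - b 0%N| = 1 - s * b 0%N.
  have := b1 0%N; rewrite ler_norml => /andP[b2 b3].
  by case: s1 => ->; [rewrite ger0_norm ?mul1r | rewrite ler0_norm]; lra.
have p0 : phase n.+1 a = fun=> if 0 < s then 0 else pi.
  by apply/funext => t /=; rewrite a01 ltxx.
set c := (if 0 < s then 0 else pi) in p0.
have [cc sc] : cos c = s /\ sin c = 0.
  rewrite /c; case: s1 => ->; first by rewrite ltr01 cos0 sin0.
  by rewrite ltr0N1 cospi sinpi.
(* If |b 0| = 1, then |s - b 0| < 1 forces b 0 = s and both phases are the same constant. *)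
case: (ltP `|b 0%N| 1) => [b01|b01]; last first.
  have -> : phase n.+1 b = phase n.+1 a.
    rewrite p0; apply/funext => t /=; rewrite ltNge b01 /= /c.
    suff -> : b 0%N = s by [].
    move: b01 d1; rewrite sb; have := b1 0%N.
    case: s1 => ->; case: (lerP 0 (b 0%N)) => h; rewrite ?(ger0_norm h) ?(ltr0_norm h); lra.
  exists (fun=> 0), (fun=> 0); split => //.
  - by move=> t; exact: is_derive_cst.
  - by move=> x; exact: cvg_cst.
  - by move=> t; rewrite /circle_dist !subrr normr0 addr0.
  - by rewrite subrr ltW.
have [qs q'0 q0 q1 qn] := phaseP n.+1 b.
have [gs g'0 _ _ _] := phaseP n (fun k => b k.+1).
pose k := 2 * (1 - s * b 0%N) / (e / 2 * (1 + s * b 0%N)).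
have k0 : 0 <= k.
  by rewrite /k divr_ge0 ?mulr_ge0 ?divr_ge0 ?(ltW e0) -?sb //; move: d1; rewrite sb; lra.
exists (fun t => e / 2 * t + k / pi * phase n.+1 b t),
       (fun t => e / 2 + k / pi * derive1 (phase n.+1 b) t); split.
- by move=> t; apply: is_derive_affine; exact: smooth_is_derive.
- by apply: continuous_affine; apply: smooth_continuous; exact: smooth_derive.
- move=> t; rewrite p0 [phase n.+1 b]/= b01.
  set q := phase n _ t + _.
  have e2 : 0 < e / 2 by rewrite divr_gt0.
  apply: le_trans (circle_dist_mob_boundary q b01 s1 cc sc e2) _.
  (* The derivative of [phase n.+1 b] is the Poisson kernel times a factor at least pi. *)
  rewrite -/k lerD2l -mulrA ler_wpM2l // derive_mob_rotate // mulrCA ler_peMr //.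
    by rewrite divr_ge0 ?subr_sqr_ge0 // ltW // mob_den_gt0.
  by rewrite ler_pdivlMl ?pi_gt0 // mulr1 lerDr.
- rewrite mulr1 mulr0 add0r.
  have kN : k * N <= e / 2.
    have h : 1 <= 1 + s * b 0%N by move: d1; rewrite sb; lra.
    have e2 : 0 < e / 2 * (1 + s * b 0%N) by rewrite mulr_gt0 ?divr_gt0 //; lra.
    rewrite /k mulrAC ler_pdivrMr //.
    have : (1 - s * b 0%N) * (8 * N) <= e ^+ 2.
      by rewrite -ler_pdivlMr ?mulr_gt0 // -sb ltW.
    have : e ^+ 2 <= e ^+ 2 * (1 + s * b 0%N) by rewrite ler_peMr // sqr_ge0.
    rewrite !expr2; lra.
  have : k / pi * (phase n.+1 b 1 - phase n.+1 b 0) <= k * N.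
    rewrite -mulrA ler_wpM2l // ler_pdivrMl ?pi_gt0 //.
  lra.
Qed.

End Phase.

(** * Circle-valued paths and their norms *)

Section CirclePaths.
Variable R : realType.
Implicit Types p q : R -> R.

Definition circle_path p : R -> Rcomplex R :=
  fun t => Complex (cos (p t)) (sin (p t)).

Lemma normRcE (x y : R) : `|Complex x y : Rcomplex R| = Num.sqrt (x ^+ 2 + y ^+ 2).
Proof. by []. Qed.

Lemma norm_circle_path p t : `|circle_path p t| = 1.
Proof. by rewrite /circle_path normRcE cos2Dsin2 sqrtr1. Qed.

Lemma Coo_circle_path p : smooth p -> Coo_circle (circle_path p).
Proof.
move=> ps; split.
- by apply: smooth_smooth01 => k; exact: (Ck_sin_cos (ps k)).2.
- by apply: smooth_smooth01 => k; exact: (Ck_sin_cos (ps k)).1.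
- by move=> t _; exact: norm_circle_path.
Qed.

Lemma L1dist_circle_path p q e : smooth p -> smooth q -> close p q e ->
  (L1dist (circle_path p) (circle_path q) <= e%:E)%E.
Proof.
move=> ps qs [F [f [Ff fc pqf Fe]]].
apply: le_trans (_ : (F 1 - F 0)%:E <= _)%E; last by rewrite lee_fin.
pose g t := Num.sqrt ((cos (p t) - cos (q t)) ^+ 2 + (sin (p t) - sin (q t)) ^+ 2).
have Cc u : smooth u -> continuous (fun t : R => cos (u t) : R).
  by move=> us; apply: smooth_continuous => k; exact: (Ck_sin_cos (us k)).2.
have Cs u : smooth u -> continuous (fun t : R => sin (u t) : R).
  by move=> us; apply: smooth_continuous => k; exact: (Ck_sin_cos (us k)).1.
apply: (@integral_le_derivative R F f g Ff fc).
  move=> t; apply: continuous_cvg; first exact: sqrt_continuous.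
  by apply: cvgD; [apply: cvgM; (apply: cvgB; exact: Cc)|apply: cvgM; (apply: cvgB; exact: Cs)].
move=> t _; rewrite sqrtr_ge0 /=; apply: le_trans (pqf t); rewrite /g /circle_dist.
move: (cos _ - _) (sin _ - _) => x y.
rewrite -[leRHS]ger0_norm ?addr_ge0 // -sqrtr_sqr ler_wsqrtr //.
rewrite sqrrD !real_normK ?num_real // -addrA lerD2l lerDr.
by rewrite mulrn_wge0 // mulr_ge0.
Qed.

(** The modulus 1 contributes the 1; the speed is p' since p' >= 0, and it integrates to the total
    turn p 1 - p 0. *)
Lemma W11norm_circle_path n p : monotone_phase n p ->
  (W11norm (circle_path p) <= (1 + pi * n%:R)%:E)%E.
Proof.
move=> [ps p'0 _ _ pn]; rewrite /W11norm EFinD; apply: leeD.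
  rewrite /L1norm (eq_integral (fun=> 1%:E)); last first.
    by move=> t _; rewrite norm_circle_path.
  by rewrite integral_cst //= lebesgue_measure_itv /= lte01 oppr0 adde0 mule1.
apply: le_trans (_ : (p 1 - p 0)%:E <= _)%E; last by rewrite lee_fin.
have pd := smooth_is_derive ps.
rewrite -(integral_derivative pd); last by apply: smooth_continuous; exact: smooth_derive.
rewrite le_eqVlt; apply/orP; left; apply/eqP; apply: eq_integral => t.
rewrite inE /= => t01; congr (_%:E); rewrite /cderiv01 normRcE.
have E := @deriv01E R _ _ t _ t01 (fun _ _ => erefl).
rewrite (E _ _ (is_derive_cos_comp (pd t))) (E _ _ (is_derive_sin_comp (pd t))).
rewrite !exprMn sqrrN -mulrDl addrC cos2Dsin2 mul1r sqrtr_sqr ger0_norm //.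
Qed.

End CirclePaths.

(** * Pulling psi back to the cube of Schur parameters *)

Theorem theorem1p3 (R : realType) (n : nat)
  (psi : (R -> Rcomplex R) -> 'rV[R]_n) :
  (0 < n)%N ->
  L1_continuous psi ->
  (forall h : R -> Rcomplex R, Coo_circle h ->
     psi (fun x => - h x) = - psi h) ->
  exists h : R -> Rcomplex R,
    [/\ Coo_circle h, psi h = 0 & (W11norm h <= (1 + pi * n%:R)%:E)%E].
Proof.
case: n psi => [//|n] psi _ psi_cont psi_odd.
(* [inord] sends indices beyond n to 0, so the whole sequence stays in [-1, 1] when [x] is in the
   cube. *)
pose par (x : 'rV[R]_n.+1) k := x 0 (inord k).
pose h x := circle_path (phase n.+1 (par x)).
have phs x : smooth (phase n.+1 (par x)) by have [] := phaseP n.+1 (par x).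
have hC x : Coo_circle (h x) by exact: Coo_circle_path.
have [||x cx hx] := @cube_borsuk_ulam R n.+1 (fun x => psi (h x)).
- move=> x cx e e0.
  have [d d0 dP] := psi_cont _ (hC x) e e0.
  (* Half of [d], because [close] yields only a weak inequality. *)
  have d2 : 0 < d / 2 by rewrite divr_gt0.
  have [r r0 rP] := @phase_continuous R n.+1 (par x) (fun k => cx (inord k)) _ d2.
  exists r => // y cy xy; apply: dP => //.
  apply: le_lt_trans (L1dist_circle_path _ _ (rP (par y) _ _)) _ => //.
  + by move=> k; exact: cy.
  + move=> k; apply: le_lt_trans xy.
    by have := row_coord_le (x - y) (inord k); rewrite !mxE.
  + by rewrite lte_fin; lra.
- move=> x y j cx cy xj xy.
  rewrite -psi_odd //; congr psi; apply/funext => t.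
  have [||||c s] := @phase_antipodal R n.+1 (par x) (par y) j t.
  + exact: ltn_ord.
  + by rewrite /par inord_val.
  + move=> i ij; apply: xy; rewrite inordK //.
    exact: leq_ltn_trans ij (ltn_ord j).
  + by move=> i; exact: cx.
  by rewrite /h /circle_path c s.
exists (h x); split => //.
exact: W11norm_circle_path (phaseP _ _).
Qed.
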